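(* Let $TI$ be the degree-based topological index determined by a symmetric function $h$, let $p_1,p_2\ge 0$ with $p_1+p_2\le 1$, let $RPoC_n=RPoC(n,p_1,p_2)$ be the random polyphenyl chain, and write $TI_n:=TI(RPoC_n)$ for $n\ge 2$. Put $$A=h_{2,2}-2h_{2,3}+h_{3,3},\qquad B=2h_{2,2}+4h_{2,3}+h_{3,3},\qquad C=4h_{2,2}-4h_{2,3}-h_{3,3}.$$ Then: (a) for every $n\ge 2$, $TI_n=AX+Bn+C$ for a random variable $X\sim \mathrm{Binomial}(n-2,p_1)$; (b) for every $n\ge 2$, $\mathbb{E}(TI_n)=(Ap_1+B)n-2Ap_1+C$; (c) for every $n\ge 2$, $\mathbb{V}(TI_n)=A^2p_1(1-p_1)(n-2)$; (d) $\dfrac{TI_n-\mathbb{E}(TI_n)}{\sqrt{\mathbb{V}(TI_n)}}$ converges in distribution to $N(0,1)$ as $n\to\infty$; (e) $\dfrac{TI_n}{n}\to Ap_1+B$ almost surely as $n\to\infty$. Moreover, for every (deterministic) polyphenyl chain $rpoc_n$ containing $n\ge 2$ hexagons, $$TI(rpoc_n)=An_1+Bn+C,$$ where $n_1$ is the number of type-1 links chosen up to time $n$, that is, in steps $3,\dots,n$ of the construction of $rpoc_n$.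
   Context: Degree-based topological index: for a function $h$ with real values and $h(x,y)=h(y,x)$ for $x,y\in\{1,2,\dots\}$, $TI(G)=\sum_{uv\in E(G)}h(d_u,d_v)$ for a finite simple connected graph $G$, where $d_v$ is the degree of $v$ in $G$. Write $h_{x,y}:=h(x,y)$. $\mathbb{E}$ and $\mathbb{V}$ denote expectation and variance, and $N(0,1)$ is the standard normal law. Polyphenyl chains: hexagons (6-cycles) in which consecutive hexagons are joined by a single edge. $RPoC_1$ is one hexagon. $RPoC_2$ consists of two vertex-disjoint hexagons together with one edge joining a vertex of the first to a vertex of the second. For $n\ge 3$, $RPoC_n$ is obtained from $RPoC_{n-1}$ as follows. Let the terminal (last added) hexagon of $RPoC_{n-1}$ have vertices $c_1,\dots,c_6$ in cyclic order, where $c_1$ is its unique vertex of degree 3. Choose a vertex $c\neq c_1$ of this hexagon, take a new vertex-disjoint hexagon, and add one edge joining $c$ to a vertex of the new hexagon. Link type 1 is the choice of $c$ adjacent to $c_1$ (ortho position, $c=c_2$ or, equivalently up to isomorphism, $c_6$); link types 2 and 3 are the choices of $c$ at distance 2 from $c_1$ (meta position, $c=c_3$ or, equivalently, $c_5$) and at distance 3 from $c_1$ (para position, $c=c_4$). The new hexagon becomes the terminal one. Random polyphenyl chain $RPoC(n,p_1,p_2)$: at each step $i\ge 3$ the link type $L_i\in\{1,2,3\}$ is chosen at random with $\mathbb{P}(L_i=1)=p_1$, $\mathbb{P}(L_i=2)=p_2$, $\mathbb{P}(L_i=3)=1-p_1-p_2$, with $L_3,L_4,\dots$ independent, and all $RPoC_n$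 are constructed successively on the same probability space. A deterministic polyphenyl chain $rpoc_n$ is a graph obtained by this construction for a fixed choice of link types in steps $3,\dots,n$.
   Formalization: Part (d) is stated under the additional assumptions A ≠ 0 and 0 < p_1 < 1, since otherwise the variance of TI_n is 0 and the normalized quotient is 0/0. *)

(* Defs.v *)
From HB Require Import structures.
From mathcomp Require Import all_boot all_order all_algebra.
From mathcomp Require Import finmap.
From mathcomp Require Import all_classical all_reals all_analysis.

Set Implicit Arguments.
Unset Strict Implicit.
Unset Printing Implicit Defensive.

Import Order.TTheory GRing.Theory Num.Theory.
Import numFieldNormedType.Exports.

Local Open Scope classical_set_scope.
Local Open Scope ring_scope.

Record sgraph := SGraph {
  vertex :> finType;
  adj : rel vertex;
  adj_sym : symmetric adj;
  adj_irr : irreflexive adj }.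

Definition degree (G : sgraph) (v : G) : nat := #|[set u | adj v u]%SET|.

Definition edges (G : sgraph) : {set {set G}} :=
  [set e : {set G} | [exists u, exists v, adj u v && (e == [set u; v])]]%SET.

(* [enum e] lists the two endpoints of an edge [e] in an arbitrary order, which
   does not matter when [h] is symmetric; the default case never occurs. *)
Definition edge_weight (R : realType) (h : nat -> nat -> R) (G : sgraph)
    (e : {set G}) : R :=
  if enum e is [:: u; v] then h (degree u) (degree v) else 0.

Definition TI (R : realType) (h : nat -> nat -> R) (G : sgraph) : R :=
  \sum_(e in edges G) edge_weight h e.

Section Hexagon.

Definition hexagon_adj : rel 'Z_6 := fun i j => (j == i + 1) || (i == j + 1).

Lemma hexagon_adj_sym : symmetric hexagon_adj.
Proof. by move=> i j; rewrite /hexagon_adj orbC. Qed.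

Lemma hexagon_adj_irr : irreflexive hexagon_adj.
Proof. by case=> -[|[|[|[|[|[|]]]]]]. Qed.

Definition hexagon : sgraph := SGraph hexagon_adj_sym hexagon_adj_irr.

End Hexagon.

(* Disjoint union of [G] and [H] plus the single edge [uv]. *)
Section JoinByEdge.
Variables (G H : sgraph) (u : G) (v : H).

Definition join_adj : rel (G + H)%type := fun x y =>
  match x, y with
  | inl a, inl b => adj a b
  | inr a, inr b => adj a b
  | inl a, inr b => (a == u) && (b == v)
  | inr a, inl b => (b == u) && (a == v)
  end.

Lemma join_adj_sym : symmetric join_adj.
Proof. by case=> [a|a] [b|b] //=; exact: adj_sym. Qed.

Lemma join_adj_irr : irreflexive join_adj.
Proof. by case=> a; exact: adj_irr. Qed.

Definition join_by_edge : sgraph := SGraph join_adj_sym join_adj_irr.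

End JoinByEdge.

(* Link types 1, 2 and 3. *)
Inductive link := Ortho | Meta | Para.

Definition link_to_ord (t : link) : 'I_3 :=
  match t with Ortho => inord 0 | Meta => inord 1 | Para => inord 2 end.
Definition ord_to_link (i : 'I_3) : link :=
  match val i with 0%N => Ortho | 1%N => Meta | _ => Para end.
Lemma link_to_ordK : cancel link_to_ord ord_to_link.
Proof. by case; rewrite /ord_to_link /= inordK. Qed.

HB.instance Definition _ := Finite.copy link (can_type link_to_ordK).
HB.instance Definition _ := isPointed.Build link Ortho.
HB.instance Definition _ := @isMeasurable.Build default_measure_display
  link discrete_measurable discrete_measurable0
  discrete_measurableC discrete_measurableU.

(* A chain under construction: a graph with its terminal hexagon, listed in
   cyclic order by [terminal 0], ..., [terminal 5]. In a chain of at least two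
   hexagons, [terminal 0] is the vertex joined to the preceding hexagon, i.e.
   c_1, and [terminal i] is c_{i+1}. *)
Record chain := Chain { graph :> sgraph; terminal : 'Z_6 -> graph }.

Definition one_hexagon : chain := @Chain hexagon id.

(* Join the vertex [terminal j] to the vertex [v] of a new hexagon. *)
Definition extend (C : chain) (j v : 'Z_6) : chain :=
  @Chain (@join_by_edge C hexagon (terminal C j) v) (fun i => inr (v + i)).

Definition link_position (t : link) (j : 'Z_6) : bool :=
  match t with
  | Ortho => (j == 1) || (j == 5%:R)
  | Meta => (j == 2%:R) || (j == 4%:R)
  | Para => j == 3%:R
  end.

(* [G 1], ..., [G n] are the successive chains obtained with link type [l i] in
   step [i], for [3 <= i <= n]. *)
Definition polyphenyl_construction (l : nat -> link) (G : nat -> chain)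
    (n : nat) : Prop :=
  [/\ G 1%N = one_hexagon,
      (2 <= n)%N -> exists u v, G 2%N = extend (G 1%N) u v
    & forall i, (3 <= i <= n)%N ->
        exists j v, link_position (l i) j /\ G i = extend (G i.-1) j v].

Section Probability.
Context d (T : measurableType d) (R : realType) (P : probability T R).

Definition mutually_independent (I : choiceType) (D : set I) d'
    (T' : measurableType d') (X : I -> {RV P >-> T'}) : Prop :=
  forall s : {fset I}, [set` s] `<=` D ->
  forall A : I -> set T', (forall i, measurable (A i)) ->
  P (\bigcap_(i in [set` s]) (X i @^-1` A i)) =
  (\prod_(i <- s) P (X i @^-1` A i))%E.

(* Finitely many initial terms are irrelevant to the limit and may fail to be
   measurable. *)
Definition cvg_in_distribution (Z : nat -> T -> R)
    (mu : probability (measurableTypeR R) R) : Prop :=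
  (\forall n \near \oo, measurable_fun [set: T] (Z n)) /\
  forall x : R, {for x, continuous (fun y : R => mu [set z | z <= y])} ->
    P [set w | Z n w <= x] @[n --> \oo] --> mu [set z | z <= x].

(* Law of the link type of each random step. *)
Definition link_law (p1 p2 : R) (t : link) : R :=
  match t with Ortho => p1 | Meta => p2 | Para => 1 - p1 - p2 end.

Definition random_links (p1 p2 : R) (L : nat -> {RV P >-> link}) : Prop :=
  (forall i t, (3 <= i)%N -> P (L i @^-1` [set t]) = (link_law p1 p2 t)%:E) /\
  mutually_independent [set i | (3 <= i)%N] L.

(* The chains [G n] are built successively along each outcome [w]. *)
Definition random_polyphenyl_chain (p1 p2 : R) (L : nat -> {RV P >-> link})
    (G : nat -> T -> chain) : Prop :=
  random_links p1 p2 L /\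
  forall w n, polyphenyl_construction (fun i => L i w) (fun k => G k w) n.

End Probability.

(* Main.v *)
From HB Require Import structures.
Require Import Defs.
From mathcomp Require Import all_boot all_order all_algebra.
From mathcomp Require Import ring lra zify finmap.
From mathcomp Require Import all_classical all_reals all_analysis.
From mathcomp Require Import measurable_realfun.

Set Implicit Arguments.
Unset Strict Implicit.
Unset Printing Implicit Defensive.

Import Order.TTheory GRing.Theory Num.Theory.
Import numFieldNormedType.Exports.

Local Open Scope classical_set_scope.
Local Open Scope ring_scope.

(** Adding a hexagon to a polyphenyl chain changes degrees only inside the
    terminal hexagon.  Writing twice the index as a sum over arcs (ordered pairs
    of adjacent vertices) makes this local: joining two graphs by an edge splits
    the sum ([arc_sum_join]), and the step adds [B] for a meta or para link and
    [A + B] for an ortho link, because only the ortho link makes the two vertices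
    of degree 3 of a hexagon adjacent ([arc_sum_inner_hexagon], [TI_extend]).
    Hence the index of a chain of [n] hexagons is [A X + B n + C], where [X] is
    the number of ortho links ([TI_polyphenyl]).

    For the random chain [X] counts the successes of [n - 2] independent trials,
    so it has the binomial law ([ortho_count_independent]); expectation and
    variance are then the first two moments of that law, and the two limit
    theorems become statements about binomial sums.

    All the moments used come from one identity, the discrete Stein equation of
    the binomial law ([binomial_mean_stein]): for [S ~ Bin(n, p)] and
    [S' ~ Bin(n - 1, p)],
      [E ((S - n p) g S) = n p (1 - p) E (g (S' + 1) - g S')].
    It gives the variance and a fourth moment of order [n ^ 2], whence the strong
    law by Markov's inequality and the Borel-Cantelli lemma
    ([ortho_count_slln]).

    The same identity proves the central limit theorem by Stein's method.  With
    [N] standard normal and [h] a test function, the equation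
    [f' x = x f x + (h x - E (h N))] has a bounded solution with bounded
    derivative ([stein_solution], from the Mills ratio bound [mills_ratio]).  For
    the standardised sum [W], [E (h W) - E (h N) = E (f' W - W f W)], and the
    discrete identity turns [E (W f W)] into the mean of a difference quotient of
    [f] over a step of order [n ^ (- 1 / 2)]; it differs from [E (f' W)] by
    [O (n ^ (- 1 / 2))] when [h] is Lipschitz ([binomial_stein_bound]).
    Piecewise linear test functions squeeze the distribution function of [W]
    between values of the normal one ([binomial_clt]). *)

(** * The index of a chain as a sum over arcs *)

Section TopologicalIndex.
Variables (R : realType) (h : nat -> nat -> R).
Hypothesis h_sym : forall x y : nat, (0 < x)%N -> (0 < y)%N -> h x y = h y x.

(** Vertices carry an arbitrary weight [D] instead of their degree because a part of
    a joined graph keeps the degrees of the whole graph, not its own. *)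
Definition arc_sum (G : sgraph) (D : G -> nat) : R :=
  \sum_(x : G) \sum_(y : G | adj x y) h (D x) (D y).

Lemma degree_gt0 (G : sgraph) (x y : G) : adj x y -> (0 < degree x)%N.
Proof. by move=> xy; apply/card_gt0P; exists y; rewrite inE. Qed.

(** The endpoints come in an unknown order, which symmetry of [h] absorbs. *)
Lemma edge_weightE (G : sgraph) (u v : G) : adj u v ->
  edge_weight h [set u; v]%SET = h (degree u) (degree v).
Proof.
move=> uv; have uDv : u != v by apply: contraTneq uv => ->; rewrite adj_irr.
have du := degree_gt0 uv.
have dv : (0 < degree v)%N by apply: (@degree_gt0 _ v u); rewrite adj_sym.
have : perm_eq (enum [set u; v]%SET) [:: u; v].
  apply: uniq_perm; rewrite ?enum_uniq //=; first by rewrite inE uDv.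
  by move=> x; rewrite mem_enum !inE.
rewrite /edge_weight; case E : (enum _) => [|x [|y [|z s]]] //;
  move=> pe; have := perm_size pe => //= _.
have := perm_mem pe x; have := perm_mem pe y.
rewrite !inE !eqxx orbT /= => /esym/orP[]/eqP yE /esym/orP[]/eqP xE; subst => //.
- by have := enum_uniq [set u; v]%SET; rewrite E /= inE eqxx.
- exact: h_sym.
- by have := enum_uniq [set u; v]%SET; rewrite E /= inE eqxx.
Qed.

(** Every edge is the image of exactly two arcs. *)
Lemma arc_sum_degree (G : sgraph) : arc_sum (@degree G) = 2 * TI h G.
Proof.
rewrite /arc_sum pair_big_dep /=.
rewrite (partition_big (fun p : G * G => [set p.1; p.2]%SET)
  (mem (edges G))) /=; last first.
  move=> -[x y] /= xy; rewrite inE; apply/existsP; exists x.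
  by apply/existsP; exists y; rewrite xy eqxx.
rewrite /TI mulr_sumr; apply: eq_bigr => e.
rewrite inE => /existsP[u /existsP[v /andP[uv /eqP ->]]].
have uDv : u != v by apply: contraTneq uv => ->; rewrite adj_irr.
rewrite edge_weightE //.
rewrite (bigD1 (u, v)) /= ?uv ?eqxx // (bigD1 (v, u)) /=; last first.
  by rewrite adj_sym uv finset.setUC eqxx xpair_eqE eq_sym (negPf uDv).
rewrite big1 => [|[x y] /=].
  rewrite addr0 (h_sym (degree_gt0 uv)) ?mulr2n ?mulrDl ?mul1r //.
  by apply: (@degree_gt0 _ v u); rewrite adj_sym.
case/andP => /andP[/andP[xy /eqP E]]; rewrite !xpair_eqE.
have xDy : x != y by apply: contraTneq xy => ->; rewrite adj_irr.
have := set21 x y; have := set22 x y; rewrite E !inE.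
by move=> /orP[]/eqP yE /orP[]/eqP xE; subst; rewrite ?eqxx in xDy *.
Qed.

Lemma eq_arc_sum (G : sgraph) (D D' : G -> nat) : D =1 D' -> arc_sum D = arc_sum D'.
Proof. by move=> E; apply: eq_bigr => x _; apply: eq_bigr => y _; rewrite !E. Qed.

Lemma arc_sum_join (G H : sgraph) (u : G) (v : H) (D : join_by_edge u v -> nat) :
  arc_sum D = arc_sum (fun x : G => D (inl x)) + arc_sum (fun x : H => D (inr x)) +
    (h (D (inl u)) (D (inr v)) + h (D (inr v)) (D (inl u))).
Proof.
rewrite /arc_sum /= (big_sumType (R:=R)) /=.
under eq_bigr do rewrite (big_sumType (R:=R)) /=.
under [X in _ + X]eq_bigr do rewrite (big_sumType (R:=R)) /=.
rewrite !big_split /=.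
have -> : \sum_(a : G) \sum_(b : H | (a == u) && (b == v)) h (D (inl a)) (D (inr b)) =
  h (D (inl u)) (D (inr v)).
  rewrite (bigD1 u) //= eqxx /= big_pred1_eq big1 ?addr0 // => a /negPf ->.
  by rewrite big_pred0.
have -> : \sum_(a : H) \sum_(b : G | (b == u) && (a == v)) h (D (inr a)) (D (inl b)) =
  h (D (inr v)) (D (inl u)).
  rewrite (bigD1 v) //= eqxx; under eq_bigl do rewrite andbT.
  rewrite big_pred1_eq big1 ?addr0 // => a /negPf ->.
  by rewrite big_pred0 // => b; rewrite andbF.
ring.
Qed.

Lemma degree_joinl (G H : sgraph) (u : G) (v : H) (x : G) :
  degree (inl x : join_by_edge u v) = (degree x + (x == u))%N.
Proof.
rewrite /degree !cardsE -!sum1_card (big_sumType (R:=nat)) /=; congr addn.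
have [->|xu] := eqVneq x u.
  by rewrite (big_pred1 v) // => b; rewrite unfold_in /= eqxx.
by rewrite big_pred0 // => b; rewrite unfold_in /= (negPf xu).
Qed.

Lemma degree_joinr (G H : sgraph) (u : G) (v : H) (x : H) :
  degree (inr x : join_by_edge u v) = (degree x + (x == v))%N.
Proof.
rewrite /degree !cardsE -!sum1_card (big_sumType (R:=nat)) /= addnC; congr addn.
have [->|xu] := eqVneq x v.
  by rewrite (big_pred1 u) // => b; rewrite unfold_in /= eqxx andbT.
by rewrite big_pred0 // => b; rewrite unfold_in /= (negPf xu) andbF.
Qed.

Lemma arc_sum_hexagon (D : hexagon -> nat) :
  arc_sum D = \sum_(i : 'Z_6) (h (D i) (D (i + 1)) + h (D (i + 1)) (D i)).
Proof.
have shift (F : 'Z_6 -> 'Z_6 -> R) :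
    \sum_i \sum_(j | i == j + 1) F i j = \sum_i F (i + 1) i.
  rewrite (exchange_big_dep xpredT) //=.
  by apply: eq_bigr => i _; rewrite big_pred1_eq.
rewrite /arc_sum big_split /= -(shift (fun i j => h (D i) (D j))) -big_split /=.
apply: eq_bigr => i _; rewrite (bigD1 (i + 1)) /hexagon_adj ?eqxx //=.
congr +%R; apply: eq_bigl => j.
case: (eqVneq j (i + 1)) => [->|]; rewrite ?andbT ?andbF //=.
by case: i => -[|[|[|[|[|[|]]]]]].
Qed.

Lemma degree_hexagon (x : hexagon) : degree x = 2%N.
Proof.
rewrite /degree cardsE.
rewrite (@eq_card _ _ (mem [:: (x : 'Z_6) + 1; (x : 'Z_6) - 1])).
  by case: x => -[|[|[|[|[|[|]]]]]] // i; apply: card_uniqP.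
move=> y; rewrite unfold_in /= /hexagon_adj.
by rewrite !unfold_in /= orbF [y == _ - _]eq_sym subr_eq.
Qed.

Local Notation A := (h 2%N 2%N - 2 * h 2%N 3%N + h 3%N 3%N).
Local Notation B := (2 * h 2%N 2%N + 4 * h 2%N 3%N + h 3%N 3%N).
Local Notation C := (4 * h 2%N 2%N - 4 * h 2%N 3%N - h 3%N 3%N).

Lemma addv_eq (v i : 'Z_6) : (v + i == v) = (i == 0).
Proof. by rewrite -[X in _ == X]addr0 (inj_eq (addrI v)). Qed.

(** The terminal hexagon has one vertex of degree 3: four of its edges join
    vertices of degree 2 and two are incident to that vertex. *)
Lemma arc_sum_end_hexagon (v : 'Z_6) :
  arc_sum (fun x : hexagon => 2 + (x == v))%N = 2 * (4 * h 2 2 + 2 * h 2 3).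
Proof.
(* rotate the hexagon so that [v] becomes 0 *)
rewrite arc_sum_hexagon (reindex_inj (addrI v)) /=.
under eq_bigr do rewrite -addrA !addv_eq.
rewrite !big_ord_recl big_ord0 /= (h_sym (x := 3) (y := 2)) //; ring.
Qed.

(** An inner hexagon has two vertices of degree 3, at distance [j].  If they are
    adjacent, one edge is of type (3, 3), two of type (2, 3), three of type (2, 2);
    otherwise four edges are of type (2, 3) and two of type (2, 2).  This is the
    only place where the link type matters. *)
Lemma arc_sum_inner_hexagon (t : link) (v j : 'Z_6) : link_position t j ->
  arc_sum (fun x : hexagon => 2 + (x == v) + (x == v + j)%R)%N =
  2 * (2 * h 2 2 + 4 * h 2 3 + (t == Ortho)%:R * A).
Proof.
move=> tj; rewrite arc_sum_hexagon (reindex_inj (addrI v)) /=.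
under eq_bigr do rewrite -addrA !addv_eq !(inj_eq (addrI v)).
rewrite !big_ord_recl big_ord0 /=.
(* the boolean equality of links goes through ordinals and does not reduce well *)
have -> : (t == Ortho) = (if t is Ortho then true else false).
  by apply/eqP; case: (t).
by case: t tj => /= [/orP[]|/orP[]|] /eqP -> /=;
  rewrite (h_sym (x := 3) (y := 2)) //; ring.
Qed.

(** The older part of the chain keeps its degrees, and so does the linking edge that
    ends at [v]: the new link leaves the hexagon at [v + j'], and [j'] is not 0.
    Of the old terms only the sum over the former terminal hexagon changes. *)
Lemma arc_sum_extend (G : chain) (t : link) (j v j' v' : 'Z_6) : link_position t j' ->
  arc_sum (@degree (extend (extend G j v) j' v')) =
  arc_sum (@degree (extend G j v)) + 2 * ((t == Ortho)%:R * A + B).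
Proof.
move=> tj.
have j0 : j' != 0 by case: t tj => /=; case: j' => -[|].
rewrite arc_sum_join (eq_arc_sum (D' := fun x : extend G j v =>
  degree x + (x == inr (v + j')%R))%N); last first.
  by move=> x; rewrite degree_joinl.
rewrite [X in _ + X + _](eq_arc_sum
  (D' := fun x : hexagon => 2 + (x == v'))%N); last first.
  by move=> x; rewrite degree_joinr degree_hexagon.
rewrite degree_joinl !degree_joinr degree_hexagon !eqxx addv_eq (negPf j0) /=.
rewrite (arc_sum_join (u := terminal G j)) (arc_sum_join (u := terminal G j)) /=.
rewrite (eq_arc_sum (D' := fun x : G => degree (inl x : extend G j v))); last first.
  by move=> x; rewrite addn0.
rewrite [X in _ + X + _ + _ + _](eq_arc_sum
  (D' := fun x : hexagon => 2 + (x == v) + (x == v + j')%R)%N); last first.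
  by move=> x; rewrite degree_joinr degree_hexagon.
rewrite [X in _ = _ + X + _ + _](eq_arc_sum
  (D' := fun x : hexagon => 2 + (x == v))%N); last first.
  by move=> x; rewrite degree_joinr degree_hexagon.
rewrite (arc_sum_inner_hexagon _ tj) !arc_sum_end_hexagon !addn0.
rewrite (_ : (inr v == inr (v + j') :> G + hexagon) = false).
  by rewrite !addn0 (degree_hexagon v'); ring.
by apply: negbTE; apply: contra j0 => /eqP[/eqP]; rewrite eq_sym addv_eq.
Qed.

Lemma TI_extend (G : chain) (t : link) (j v j' v' : 'Z_6) : link_position t j' ->
  TI h (extend (extend G j v) j' v') = TI h (extend G j v) + (t == Ortho)%:R * A + B.
Proof.
move=> tj; apply: (mulfI (x := 2)); first by rewrite pnatr_eq0.
rewrite -!arc_sum_degree (arc_sum_extend _ _ _ _ tj) arc_sum_degree; ring.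
Qed.

Lemma TI_two_hexagons (u v : 'Z_6) : TI h (extend one_hexagon u v) = 2 * B + C.
Proof.
apply: (mulfI (x := 2)); first by rewrite pnatr_eq0.
rewrite -arc_sum_degree arc_sum_join.
rewrite [X in X + _ + _](eq_arc_sum
  (D' := fun x : hexagon => 2 + (x == u))%N); last first.
  by move=> x; rewrite degree_joinl degree_hexagon.
rewrite [X in _ + X + _](eq_arc_sum
  (D' := fun x : hexagon => 2 + (x == v))%N); last first.
  by move=> x; rewrite degree_joinr degree_hexagon.
rewrite degree_joinl degree_joinr !degree_hexagon !eqxx !arc_sum_end_hexagon; ring.
Qed.

(** Induction on the number of hexagons, from two on; the second component of the
    invariant exposes the terminal hexagon needed by [TI_extend]. *)
Lemma TI_polyphenyl (l : nat -> link) (G : nat -> chain) (n : nat) :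
  (2 <= n)%N -> polyphenyl_construction l G n ->
  TI h (G n) = A * (\sum_(3 <= i < n.+1) (l i == Ortho))%N%:R + B * n%:R + C.
Proof.
move=> n2 [G1 G2 G3].
suff /(_ n n2 (leqnn n))[//] : forall m, (2 <= m)%N -> (m <= n)%N ->
    TI h (G m) = A * (\sum_(3 <= i < m.+1) (l i == Ortho))%N%:R + B * m%:R + C /\
    exists C j v, G m = extend C j v.
elim=> [//|m IH] m2 mn; have [m1|mN1] := eqVneq m 1%N.
  have [u [v E]] := G2 n2; split; last by exists (G 1), u, v; rewrite m1 E.
  rewrite m1 E G1 TI_two_hexagons big_geq //; ring.
have m2' : (2 <= m)%N by lia.
have [|TIm [G0 [j [v Gm]]]] := IH m2'; first lia.
have [|j' [v' [tj]]] := G3 m.+1; first lia.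
rewrite /= => E; split; last by exists (G m), j', v'.
rewrite E Gm (TI_extend _ _ _ _ tj) -Gm TIm [in RHS]big_nat_recr //=.
rewrite natrD -[m.+1%:R]natr1; ring.
Qed.

End TopologicalIndex.

(** * Means over the binomial distribution *)

Section BinomialMean.
Variables (R : realType) (p : R).
Implicit Types (n : nat) (f g : nat -> R).
Local Notation q := (1 - p).

Definition binomial_mean n f : R := \sum_(k < n.+1) binomial_pmf n p k * f k.

Lemma eq_binomial_mean n f g : f =1 g -> binomial_mean n f = binomial_mean n g.
Proof. by move=> fg; apply: eq_bigr => k _; rewrite fg. Qed.

Lemma binomial_mean0 f : binomial_mean 0 f = f 0%N.
Proof.
by rewrite /binomial_mean big_ord1 /binomial_pmf bin0 subn0 !expr0 mulr1 mulr1n mul1r.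
Qed.

(** Conditioning on the last of [n + 1] trials. *)
Lemma binomial_meanS n f :
  binomial_mean n.+1 f =
  p * binomial_mean n (fun k => f k.+1) + q * binomial_mean n f.
Proof.
rewrite /binomial_mean big_ord_recl /= !mulr_sumr.
have pmfS (k : nat) : binomial_pmf n.+1 p k.+1 =
    p * binomial_pmf n p k + q * binomial_pmf n p k.+1.
  rewrite /binomial_pmf binS mulrnDr subSS addrC; congr +%R.
    by rewrite exprS -mulrA mulrnAr.
  have [nk|kn] := ltnP k n; last by rewrite bin_small // !mulr0n mulr0.
  by rewrite -(subnSK nk) (exprS _ (n - k.+1)) mulrnAr mulrCA.
have pmf0 : binomial_pmf n.+1 p 0 = q * binomial_pmf n p 0.
  by rewrite /binomial_pmf !bin0 !subn0 !expr0 !mul1r !mulr1n exprS.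
under eq_bigr => i _ do rewrite /bump /= add1n pmfS mulrDl -!mulrA.
rewrite big_split /= pmf0 addrCA -mulrA; congr +%R.
rewrite [RHS]big_ord_recl /=; congr +%R.
rewrite big_ord_recr /= {2}/binomial_pmf bin_small // mulr0n mul0r mulr0 addr0.
by apply: eq_bigr.
Qed.

Lemma binomial_meanD n f g :
  binomial_mean n (fun k => f k + g k) = binomial_mean n f + binomial_mean n g.
Proof. by rewrite -big_split; apply: eq_bigr => k _ /=; rewrite mulrDr. Qed.

Lemma binomial_meanZ n a f :
  binomial_mean n (fun k => a * f k) = a * binomial_mean n f.
Proof. by rewrite mulr_sumr; apply: eq_bigr => k _ /=; rewrite mulrCA. Qed.

Lemma binomial_meanB n f g :
  binomial_mean n (fun k => f k - g k) = binomial_mean n f - binomial_mean n g.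
Proof.
rewrite -mulN1r -binomial_meanZ -binomial_meanD.
by apply: eq_binomial_mean => k; rewrite mulN1r.
Qed.

Lemma binomial_mean_cst n a : binomial_mean n (fun=> a) = a.
Proof. by elim: n => [|n IH]; rewrite ?binomial_mean0 // binomial_meanS !IH; ring. Qed.

(** The discrete Stein equation of the binomial law.  It replaces a factor
    [k - n p] by a difference operator and lowers the number of trials by one. *)
Lemma binomial_mean_stein n g :
  binomial_mean n.+1 (fun k => (k%:R - n.+1%:R * p) * g k) =
  n.+1%:R * p * q * binomial_mean n (fun k => g k.+1 - g k).
Proof.
have split1 c f1 m : binomial_mean m (fun k => (k%:R - m%:R * p + c) * f1 k) =
    binomial_mean m (fun k => (k%:R - m%:R * p) * f1 k) + c * binomial_mean m f1.
  by rewrite -binomial_meanZ -binomial_meanD; apply: eq_binomial_mean => k; ring.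
elim: n g => [|n IH] g.
  by rewrite binomial_meanS !binomial_mean0; ring.
rewrite binomial_meanS.
rewrite (@eq_binomial_mean _ _
  (fun k => (k%:R - n.+1%:R * p + q) * g k.+1)); last first.
  by move=> k; rewrite -[k.+1%:R]natr1 -[n.+2%:R]natr1; ring.
rewrite [in X in _ + X](@eq_binomial_mean _ _
  (fun k => (k%:R - n.+1%:R * p - p) * g k)); last first.
  by move=> k; rewrite -[n.+2%:R]natr1; ring.
rewrite !split1 !IH.
have -> : p * (n.+1%:R * p * q * binomial_mean n (fun k => g k.+2 - g k.+1) +
     q * binomial_mean n.+1 (fun k => g k.+1)) +
   q * (n.+1%:R * p * q * binomial_mean n (fun k => g k.+1 - g k) +
     - p * binomial_mean n.+1 g) =
   n.+1%:R * p * q * binomial_mean n.+1 (fun k => g k.+1 - g k) +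
   p * q * (binomial_mean n.+1 (fun k => g k.+1) - binomial_mean n.+1 g).
  by rewrite [in RHS]binomial_meanS; ring.
by rewrite -binomial_meanB binomial_meanS -[n.+2%:R]natr1; ring.
Qed.

Hypothesis p01 : 0 <= p <= 1.

Lemma binomial_mean_ge0 n f : (forall k, 0 <= f k) -> 0 <= binomial_mean n f.
Proof. by move=> f0; apply: sumr_ge0 => k _; rewrite mulr_ge0 ?binomial_pmf_ge0. Qed.

Lemma le_binomial_mean n f g : (forall k, f k <= g k) ->
  binomial_mean n f <= binomial_mean n g.
Proof. by move=> fg; apply: ler_sum => k _; rewrite ler_wpM2l ?binomial_pmf_ge0. Qed.

Lemma ler_norm_binomial_mean n f :
  `|binomial_mean n f| <= binomial_mean n (fun k => `|f k|).
Proof.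
apply: le_trans (ler_norm_sum _ _ _) _; apply: ler_sum => k _.
by rewrite normrM ger0_norm ?binomial_pmf_ge0.
Qed.

Lemma binomial_mean_id n : binomial_mean n (fun k => k%:R) = n%:R * p.
Proof.
elim: n => [|n IH]; first by rewrite binomial_mean0 mul0r.
rewrite binomial_meanS (@eq_binomial_mean _ _ (fun k => k%:R + 1)) => [|k];
  last by rewrite natr1.
by rewrite binomial_meanD binomial_mean_cst IH -[n.+1%:R]natr1; ring.
Qed.

Lemma binomial_mean_var n :
  binomial_mean n (fun k => (k%:R - n%:R * p) ^+ 2) = n%:R * p * q.
Proof.
case: n => [|n]; first by rewrite binomial_mean0; ring.
rewrite (@eq_binomial_mean _ _
  (fun k => (k%:R - n.+1%:R * p) * (k%:R - n.+1%:R * p))) //.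
rewrite binomial_mean_stein (@eq_binomial_mean _ _ (fun=> 1)) ?binomial_mean_cst ?mulr1 //
  => k.
by rewrite -[k.+1%:R]natr1; ring.
Qed.

(** Two uses of the Stein equation: the first turns the fourth moment into the mean
    of a quadratic polynomial, the second evaluates its variance term.  The constant
    is not sharp; only the order [n ^ 2] matters for the strong law. *)
Lemma binomial_mean_fourth n :
  binomial_mean n (fun k => (k%:R - n%:R * p) ^+ 4) <= 5 * n%:R ^+ 2.
Proof.
have [p0 p1] := andP p01.
case: n => [|n]; first by rewrite binomial_mean0 expr0n mul0r subrr expr0n mulr0.
pose y (k : nat) : R := k%:R - n.+1%:R * p.
rewrite (@eq_binomial_mean _ _ (fun k => (k%:R - n.+1%:R * p) * y k ^+ 3)) => [|k];
  last by rewrite -exprS.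
rewrite binomial_mean_stein.
have le1 : binomial_mean n (fun k => y k.+1 ^+ 3 - y k ^+ 3) <= 5 * n.+1%:R.
  apply: (@le_trans _ _ (binomial_mean n (fun k => 5 * (k%:R - n%:R * p) ^+ 2 + 3))).
    apply: le_binomial_mean => k; rewrite /y -[k.+1%:R]natr1 -[n.+1%:R]natr1.
    set z := k%:R - n%:R * p.
    have -> : k%:R - (n%:R + 1) * p = z - p by rewrite /z; ring.
    have -> : k%:R + 1 - (n%:R + 1) * p = z - p + 1 by rewrite /z; ring.
    (* the gap is the sum of nonnegative terms shown below *)
    have h1 := sqr_ge0 (z - (1 - 2 * p)).
    have h2 : 0 <= p * (1 - p) by rewrite mulr_ge0 // subr_ge0.
    have h3 := sqr_ge0 z.
    rewrite -subr_ge0.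
    have -> : 5 * z ^+ 2 + 3 - ((z - p + 1) ^+ 3 - (z - p) ^+ 3) =
      3 / 2 * (z - (1 - 2 * p)) ^+ 2 + 9 * (p * (1 - p)) + z ^+ 2 / 2 + 1 / 2 by field.
    lra.
  rewrite binomial_meanD binomial_meanZ binomial_mean_var binomial_mean_cst.
  rewrite -[n.+1%:R]natr1.
  have : 0 <= n%:R :> R by [].
  nra.
apply: (@le_trans _ _ (n.+1%:R * p * q * (5 * n.+1%:R))).
  by rewrite ler_wpM2l // !mulr_ge0 // subr_ge0.
have -> : n.+1%:R * p * q * (5 * n.+1%:R) = 5 * n.+1%:R ^+ 2 * (p * q) by ring.
by apply: ler_piMr; [rewrite mulr_ge0 ?sqr_ge0|apply: mulr_ile1 => //; lra].
Qed.

End BinomialMean.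

(** * Stein's equation for the standard normal law *)

Section RealFunctions.
Variable R : realType.

Lemma is_derive_MVT (f df : R -> R) (a b : R) : a <= b ->
  (forall x, a <= x <= b -> is_derive x 1 f (df x)) ->
  exists2 c, a <= c <= b & f b - f a = df c * (b - a).
Proof.
move=> ab fdf; have [||c] := @MVT_segment R f df a b ab.
- by move=> x; rewrite in_itv /= => /andP[/ltW ax /ltW xb]; apply: fdf; rewrite ax.
- apply: derivable_within_continuous => x; rewrite in_itv /= => /fdf.
  by case.
- by rewrite in_itv /= => ? ?; exists c.
Qed.

Lemma is_derive_MVT_unordered (f df : R -> R) (a b : R) :
  (forall x : R, is_derive x 1 f (df x)) ->
  exists2 c, `|a - c| <= `|b - a| /\ `|b - c| <= `|b - a| &
    f b - f a = df c * (b - a).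
Proof.
move=> fdf; have [ab|/ltW ba] := leP a b.
  have [c /andP[ac cb] E] := is_derive_MVT ab (fun x _ => fdf x); exists c => //.
  by rewrite distrC !ger0_norm ?subr_ge0 //; lra.
have [c /andP[bc ca] E] := is_derive_MVT ba (fun x _ => fdf x); exists c.
  by rewrite !(distrC b) !ger0_norm ?subr_ge0 //; lra.
by rewrite -opprB E -mulrN opprB.
Qed.

Lemma lipschitz_const_ge0 (h : R -> R) (L : R) :
  (forall x y, `|h x - h y| <= L * `|x - y|) -> 0 <= L.
Proof.
by move=> hL; have := le_trans (normr_ge0 _) (hL 1 0); rewrite subr0 normr1 mulr1.
Qed.

Lemma lipschitz_continuous (h : R -> R) (L : R) :
  (forall x y, `|h x - h y| <= L * `|x - y|) -> continuous h.
Proof.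
move=> hL x; have L0 := lipschitz_const_ge0 hL; apply/cvgrPdist_le => e e0; near=> y.
apply: le_trans (hL _ _) _.
apply: (@le_trans _ _ (`|x - y| * (L + 1))); first by rewrite mulrC ler_wpM2l // lerDl.
rewrite -ler_pdivlMr ?ltr_wpDl //.
near: y; apply: cvgr_dist_le; first exact: cvg_id.
by rewrite divr_gt0 // ltr_wpDl.
Unshelve. all: by end_near. Qed.

End RealFunctions.

Section Stein.
Variable R : realType.
Implicit Types x t : R.
Local Notation mu := lebesgue_measure.
Local Notation w := (@normal_pdf R 0 1).

Lemma normal_pdf01E x : w x = @normal_peak R 1 * expR (- (x ^+ 2 / 2)).
Proof. by rewrite normal_pdfE ?oner_neq0 // /normal_fun subr0 expr1n mulNr. Qed.

Lemma normal_pdf01_gt0 x : 0 < w x.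
Proof. by rewrite normal_pdf01E mulr_gt0 ?expR_gt0 ?normal_peak_gt0 ?oner_neq0. Qed.

Lemma is_derive_normal_pdf01 x : is_derive x 1 w (- (x * w x)).
Proof.
have -> : w = (fun x => @normal_peak R 1 * expR (- (x ^+ 2 / 2))).
  by apply/funext => y; rewrite normal_pdf01E.
by apply: is_derive_eq; rewrite /GRing.scale /=; field.
Qed.

(** The Mills ratio bound, obtained without estimating integrals: for [s = 1] or
    [s = -1] the function [w t / t + s F t] has derivative
    [- w t - w t / t ^ 2 + s g t w t <= 0] on each half-line and vanishes at
    infinity, so it is nonnegative on the right and nonpositive on the left of 0. *)
Lemma mills_ratio (F g : R -> R) :
  (forall x, is_derive x 1 F (g x * w x)) -> (forall x, `|g x| <= 1) ->
  F x @[x --> +oo%R] --> 0 -> F x @[x --> -oo%R] --> 0 ->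
  forall x, `|x * F x| <= w x.
Proof.
move=> dF g1 Fy FNy x.
pose D s (t : R) := w t / t + s * F t.
have dD s t : t != 0 -> is_derive t 1 (D s) (- w t - w t / t ^+ 2 + s * (g t * w t)).
  move=> t0; have dw := is_derive_normal_pdf01 t.
  have dV := @is_deriveV R id t 1 1 t0 (is_derive_id _ _).
  apply: (is_derive_eq (is_deriveD (is_deriveM dw dV) (is_deriveZ s (dF t)))).
  by rewrite /GRing.scale /=; field.
have D'le0 s t : `|s| = 1 -> - w t - w t / t ^+ 2 + s * (g t * w t) <= 0.
  move=> s1; have w0 := normal_pdf01_gt0 t.
  have : s * g t <= 1 by rewrite (le_trans (ler_norm _)) // normrM s1 mul1r.
  have : 0 <= w t / t ^+ 2 by rewrite divr_ge0 ?sqr_ge0 // ltW.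
  rewrite mulrA; nra.
have Dmono s a b : `|s| = 1 -> a <= b -> 0 < a * b -> D s b <= D s a.
  move=> s1 ab ab0.
  have dDab t : a <= t <= b ->
      is_derive t 1 (D s) (- w t - w t / t ^+ 2 + s * (g t * w t)).
    move=> /andP[at_ tb]; apply: dD; apply/eqP => t0; subst t.
    move: ab0; rewrite ltNge mulr_le0_ge0 //.
  have [c _ E] := is_derive_MVT ab dDab.
  by rewrite -subr_le0 E mulr_le0_ge0 ?D'le0 ?subr_ge0.
(* both signs of [s] together bound the absolute value of [F] *)
have absF t : t != 0 -> 0 <= w t / `|t| + F t -> 0 <= w t / `|t| - F t ->
    `|t * F t| <= w t.
  move=> t0 h1 h2; rewrite normrM mulrC -ler_pdivlMr ?normr_gt0 // ler_norml.
  by apply/andP; split; lra.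
have normw t : w t / `|t| >= 0 by rewrite divr_ge0 // ltW ?normal_pdf01_gt0.
have [x0|x0|->] := ltgtP x 0; last by rewrite mul0r normr0 ltW ?normal_pdf01_gt0.
- have Dle0 (s : R) : `|s| = 1 -> D s x <= 0.
    move=> s1; rewrite leNgt; apply/negP => Dx.
    have [N [_ FN]] := @cvgr0_norm_lt _ _ _ _ _ _ FNy _ Dx.
    have [y yN yx] : exists2 y, y < N & y <= x.
      by case: (ltP x N) => ?; [exists x|exists (N - 1)]; lra.
    have y0 : y < 0 by lra.
    have := Dmono s _ _ s1 yx; rewrite nmulr_rgt0 // => /(_ x0).
    have := FN y yN; rewrite /D => ? ?.
    have := ler_norm (s * F y); rewrite normrM s1 mul1r.
    have := normw y; rewrite (ler0_norm (ltW y0)) invrN mulrN.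
    lra.
  apply: absF; rewrite ?lt_eqF // (ler0_norm (ltW x0)) invrN mulrN.
    by have := Dle0 (-1); rewrite normrN1 /D => /(_ erefl); lra.
  by have := Dle0 1; rewrite normr1 /D => /(_ erefl); lra.
- have Dge0 (s : R) : `|s| = 1 -> 0 <= D s x.
    move=> s1; rewrite leNgt; apply/negP; rewrite -oppr_gt0 => Dx.
    have [N [_ FN]] := @cvgr0_norm_lt _ _ _ _ _ _ Fy _ Dx.
    have [y yN yx] : exists2 y, N < y & x <= y.
      by case: (ltP N x) => ?; [exists x|exists (N + 1)]; lra.
    have y0 : 0 < y by lra.
    have := Dmono s _ _ s1 yx; rewrite pmulr_rgt0 // => /(_ y0).
    have := FN y yN; rewrite /D in Dx * => Fy1.
    have := ler_norm (- (s * F y)); rewrite normrN normrM s1 mul1r.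
    have := normw y; rewrite (ger0_norm (ltW y0)).
    lra.
  apply: absF; rewrite ?gt_eqF // (ger0_norm (ltW x0)).
    by have := Dge0 1; rewrite normr1 /D => /(_ erefl); lra.
  by have := Dge0 (-1); rewrite normrN1 /D => /(_ erefl); lra.
Qed.

(* the identity as a random variable whose law is the normal law *)
Let idTR : measurableTypeR R -> R := idfun.
#[local] HB.instance Definition _ :=
  @isMeasurableFun.Build _ _ _ _ idTR (@measurable_id _ _ setT).

Lemma cvg_normal_cdfNy : \int[mu]_(t in `]-oo, x]) w t @[x --> -oo%R] --> 0.
Proof.
have := @cvg_cdfNy0 _ _ R (@normal_prob R 0 1) (idTR : {RV (normal_prob 0 1) >-> R}).
by move/fine_cvg.
Qed.

Lemma cvg_normal_ccdfy : \int[mu]_(t in `]x, +oo[) w t @[x --> +oo%R] --> 0.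
Proof.
have := @cvg_ccdfy0 _ _ R (@normal_prob R 0 1) (idTR : {RV (normal_prob 0 1) >-> R}).
by move/fine_cvg.
Qed.

Section SteinSolution.
Variable h : R -> R.
Hypotheses (hC : continuous h) (h01 : forall x, 0 <= h x <= 1).

Definition normal_mean := \int[mu]_t (h t * w t).
Local Notation c := normal_mean.

Lemma measurable_mul_pdf : measurable_fun setT (fun t => h t * w t).
Proof.
apply: measurable_funM; last exact: measurable_normal_pdf.
by apply: continuous_measurable_fun.
Qed.

Lemma integrable_pdf01 D : measurable D -> mu.-integrable D (EFin \o w).
Proof.
move=> mD; apply: integrableS (integrable_normal_pdf 0 1) => //.
Qed.

Lemma integrable_mul_pdf : mu.-integrable setT (EFin \o (fun t => h t * w t)).
Proof.
apply: le_integrable (integrable_pdf01 measurableT) => //.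
  by apply/measurable_EFinP; exact: measurable_mul_pdf.
move=> x _ /=; have /andP[h0 h1] := h01 x.
rewrite lee_fin normrM ler_piMl // ger0_norm //.
Qed.

Lemma Rintegral_pdf01 : \int[mu]_t w t = 1.
Proof. by rewrite /Rintegral integral_normal_pdf. Qed.

Lemma normal_mean01 : 0 <= c <= 1.
Proof.
apply/andP; split.
  apply: Rintegral_ge0 => x _; rewrite mulr_ge0 ?normal_pdf_ge0 //.
  by have /andP[] := h01 x.
rewrite -Rintegral_pdf01; apply: le_Rintegral => //.
- exact: integrable_mul_pdf.
- exact: integrable_pdf01.
- by move=> x _; have /andP[h0 h1] := h01 x; rewrite ler_piMl // normal_pdf_ge0.
Qed.

Definition centered x := h x - c.
Definition centered_pdf x := centered x * w x.
(** Its quotient by [w] solves the Stein equation; integrating from minus infinity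
    makes it vanish at both ends. *)
Definition stein_primitive x := \int[mu]_(t in `]-oo, x]) centered_pdf t.
Local Notation g := centered.
Local Notation gw := centered_pdf.
Local Notation F := stein_primitive.

Lemma norm_centered_le1 x : `|g x| <= 1.
Proof.
have /andP[h0 h1] := h01 x; have /andP[c0 c1] := normal_mean01.
by rewrite ler_norml /centered; lra.
Qed.

Lemma norm_centered_pdf_le x : `|gw x| <= w x.
Proof.
rewrite normrM (ger0_norm (normal_pdf_ge0 0 1 x)).
by rewrite ler_piMl ?normal_pdf_ge0 ?norm_centered_le1.
Qed.

Lemma continuous_centered : continuous g.
Proof. by move=> x; apply: cvgB; [exact: hC|exact: cvg_cst]. Qed.

Lemma continuous_centered_pdf : continuous gw.
Proof.
move=> x; apply: cvgM; first exact: continuous_centered.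
by apply: continuous_normal_pdf; exact: oner_neq0.
Qed.

Lemma integrable_centered_pdf D : measurable D -> mu.-integrable D (EFin \o gw).
Proof.
move=> mD; apply: le_integrable (integrable_pdf01 mD) => //.
  apply/measurable_EFinP; apply: measurable_funTS.
  by apply: continuous_measurable_fun; exact: continuous_centered_pdf.
move=> x _ /=.
by rewrite lee_fin (ger0_norm (normal_pdf_ge0 0 1 x)) norm_centered_pdf_le.
Qed.

Lemma is_derive_stein_primitive x : is_derive x 1 F (gw x).
Proof.
have xx1 : x < x + 1 by rewrite ltrDl.
have mI : measurable [set` Interval -oo%O (BRight (x + 1))] by exact: measurable_itv.
have [dF F'] := continuous_FTC1 xx1 (integrable_centered_pdf mI) (ltNyr _)
  (@continuous_centered_pdf x).
by apply: DeriveDef; [exact: dF|rewrite -derive1E; exact: F'].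
Qed.

Lemma norm_Rintegral_centered_le D : measurable D ->
  `|\int[mu]_(t in D) gw t| <= \int[mu]_(t in D) w t.
Proof.
move=> mD; apply: le_trans (le_normr_Rintegral mD (integrable_centered_pdf mD)) _.
apply: le_Rintegral => //; last by move=> x _; exact: norm_centered_pdf_le.
  by have /integrable_norm := integrable_centered_pdf mD.
exact: integrable_pdf01.
Qed.

(** The total mass of [centered_pdf] is 0, so the primitive is also minus the right
    tail; this gives its limit at plus infinity. *)
Lemma stein_primitive_tail x : F x = - \int[mu]_(t in `]x, +oo[) gw t.
Proof.
have : \int[mu]_t gw t = 0.
  rewrite /centered_pdf /centered; under eq_Rintegral do rewrite mulrBl.
  rewrite RintegralB //.
  - rewrite RintegralZl // ?Rintegral_pdf01 ?mulr1 ?subrr //.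
    exact: integrable_pdf01.
  - exact: integrable_mul_pdf.
  - by have := integrableZl measurableT c (integrable_pdf01 measurableT).
rewrite -(itv_setU_setT false x) Rintegral_setU //.
- by move/eqP; rewrite addr_eq0 => /eqP.
- by apply: integrable_centered_pdf; exact: measurableU.
- exact: disjoint_rays.
Qed.

Lemma cvg_stein_primitiveNy : F x @[x --> -oo%R] --> 0.
Proof.
apply/norm_cvg0P; apply: (squeeze_cvgr _ (cvg_cst 0) cvg_normal_cdfNy).
by apply: nearW => x; rewrite normr_ge0 /=; exact: norm_Rintegral_centered_le.
Qed.

Lemma cvg_stein_primitivey : F x @[x --> +oo%R] --> 0.
Proof.
apply/norm_cvg0P; apply: (squeeze_cvgr _ (cvg_cst 0) cvg_normal_ccdfy).
apply: nearW => x; rewrite normr_ge0 stein_primitive_tail normrN /=.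
exact: norm_Rintegral_centered_le.
Qed.

(** The solution is [F / w] with [F] the primitive of [(h - c) w].  The Mills bound
    gives [|x f x| <= 1], hence boundedness of [f] for [|x| >= 1]; near 0 one uses
    that [w] is bounded below by [w 1]. *)
Lemma stein_solution : exists2 f : R -> R,
  forall x, is_derive x 1 f (x * f x + (h x - c)) &
  exists2 K, (forall x, `|f x| <= K) & forall x, `|x * f x| <= 1.
Proof.
have w0 x : w x != 0 by rewrite gt_eqF ?normal_pdf01_gt0.
have mills x : `|x * (F x / w x)| <= 1.
  rewrite mulrA normrM normfV (gtr0_norm (normal_pdf01_gt0 x)).
  rewrite ler_pdivrMr ?normal_pdf01_gt0 // mul1r.
  exact: (mills_ratio is_derive_stein_primitive norm_centered_le1
    cvg_stein_primitivey cvg_stein_primitiveNy).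
exists (fun x => F x / w x) => [x|].
  have dV := @is_deriveV R w x _ 1 (w0 x) (is_derive_normal_pdf01 x).
  apply: (is_derive_eq (is_deriveM (is_derive_stein_primitive x) dV)).
  by rewrite /GRing.scale /= /centered_pdf /centered; field.
exists (1 + (w 1)^-1) => [x|//].
have [x1|x1] := leP 1 `|x|.
  apply: le_trans (_ : 1 <= _); last by rewrite lerDl invr_ge0 normal_pdf_ge0.
  apply: le_trans (mills x); rewrite [leRHS]normrM; exact: ler_peMl.
apply: le_trans (_ : (w 1)^-1 <= _); last by rewrite lerDr.
rewrite normrM normfV (gtr0_norm (normal_pdf01_gt0 x)).
have F1 : `|F x| <= 1.
  apply: le_trans (norm_Rintegral_centered_le _) _ => //.
  rewrite -lee_fin [_%:E]fineK; last first.
    by apply: integrable_fin_num => //; exact: integrable_pdf01.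
  apply: (@probability_le1 _ _ _ (@normal_prob R 0 1) `]-oo, x]).
  exact: measurable_itv.
apply: le_trans (_ : 1 / w x <= _).
  by rewrite ler_wpM2r // invr_ge0 normal_pdf_ge0.
rewrite mul1r lef_pV2 ?posrE ?normal_pdf01_gt0 // !normal_pdf01E.
rewrite ler_wpM2l ?normal_peak_ge0 // ler_expR lerN2 ler_pM2r ?invr_gt0 //.
by rewrite expr1n -real_normK ?num_real // expr_le1 // ltW.
Qed.

End SteinSolution.
End Stein.

(** * The central limit theorem for the binomial distribution *)

Section SteinBound.
Variables (R : realType) (p : R).
Hypothesis p01 : 0 < p < 1.
Local Notation q := (1 - p).

Let p01w : 0 <= p <= 1.
Proof. by case/andP: p01 => /ltW-> /ltW->. Qed.

Variables (h : R -> R) (L : R).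
Hypotheses (h01 : forall x, 0 <= h x <= 1).
Hypothesis hL : forall x y, `|h x - h y| <= L * `|x - y|.

(** The quantitative central limit theorem for Lipschitz test functions.  The
    number [e] is the inverse of the standard deviation up to sign: a negative [e]
    standardises the opposite of the binomial variable. *)
Lemma binomial_stein_bound : exists M : R, forall n (e : R), `|e| <= 1 ->
  e ^+ 2 * (n.+1%:R * p * q) = 1 ->
  `|binomial_mean p n.+1 (fun k => h ((k%:R - n.+1%:R * p) * e)) - normal_mean h|
    <= `|e| * M.
Proof.
have [f df [K fK xf1]] := stein_solution (lipschitz_continuous hL) h01.
have [p0 p1] := andP p01; have q0 : 0 < q by lra.
set c := normal_mean h in df *.
pose f' x := x * f x + (h x - c).
have c01 : 0 <= c <= 1 := normal_mean01 (lipschitz_continuous hL) h01.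
have f'2 x : `|f' x| <= 2.
  rewrite (le_trans (ler_normD _ _)) // -[2]/(1 + 1) lerD //.
  by rewrite ler_norml; have := h01 x; lra.
have fLip x y : `|f x - f y| <= 2 * `|x - y|.
  have [z _ ->] := is_derive_MVT_unordered y x df.
  by rewrite normrM ler_wpM2r //; exact: f'2.
exists (q^-1 + 3 + K + L) => n e e1 enpq.
pose W (k : nat) : R := (k%:R - n.+1%:R * p) * e.
have WS k : W k.+1 = W k + e by rewrite /W -natr1; ring.
(* the second moment over one trial less, from the variance over [n + 1] trials *)
have EW2 : binomial_mean p n (fun k => W k ^+ 2) <= q^-1.
  have : binomial_mean p n.+1 (fun k => W k ^+ 2) = 1.
    under eq_binomial_mean do rewrite /W exprMn mulrC.
    by rewrite binomial_meanZ binomial_mean_var.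
  rewrite binomial_meanS => E; rewrite -[q^-1]mul1r ler_pdivlMr // mulrC.
  suff : 0 <= p * binomial_mean p n (fun k => W k.+1 ^+ 2) by lra.
  by rewrite mulr_ge0 ?(ltW p0) // binomial_mean_ge0 // => k; exact: sqr_ge0.
(* Stein's equation and its discrete form, both as means over [n] trials *)
pose D k : R := p * f' (W k.+1) + q * f' (W k) -
     e * (n.+1%:R * p * q) * (f (W k.+1) - f (W k)).
have -> : binomial_mean p n.+1 (fun k => h (W k)) - c = binomial_mean p n D.
  rewrite /D binomial_meanB binomial_meanD !binomial_meanZ -binomial_meanS.
  rewrite -mulrA -(binomial_mean_stein p n (fun k => f (W k))) -binomial_meanZ.
  rewrite -binomial_meanB -{1}(binomial_mean_cst p n.+1 c) -binomial_meanB.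
  by apply: eq_binomial_mean => k; rewrite /f' /W; ring.
(* the mean value theorem makes [D k] a combination of increments of [f'] over
   distances at most [|e|] *)
have DW k : `|D k| <= `|e| * (W k ^+ 2 + (3 + K + L)).
  set a := W k; have aS : W k.+1 = a + e := WS k.
  have [z [az bz] E] := is_derive_MVT_unordered a (a + e) df.
  rewrite (addrC a e) addrK (addrC e a) in az bz E.
  have f'z u : `|u - z| <= `|e| -> `|u| <= `|a| + 1 ->
      `|f' u - f' z| <= `|e| * (a ^+ 2 + (3 + K + L)).
    move=> uz ua.
    have -> : f' u - f' z = u * (f u - f z) + (u - z) * f z + (h u - h z).
      by rewrite /f'; ring.
    have e0 := normr_ge0 e; have a0 := normr_ge0 a; have u0 := normr_ge0 u.
    have h1 : `|u * (f u - f z)| <= (`|a| + 1) * (2 * `|e|).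
      by rewrite normrM ler_pM // (le_trans (fLip _ _)) // ler_wpM2l.
    have h2 : `|(u - z) * f z| <= `|e| * K by rewrite normrM ler_pM.
    have L0 := lipschitz_const_ge0 hL.
    have h3 : `|h u - h z| <= L * `|e| by rewrite (le_trans (hL _ _)) // ler_wpM2l.
    have h4 : 2 * `|a| <= a ^+ 2 + 1.
      by rewrite -real_normK ?num_real //; have := sqr_ge0 (`|a| - 1); nra.
    rewrite (le_trans (ler_normD _ _)) //.
    rewrite (le_trans (lerD (ler_normD _ _) (lexx _))) //.
    nra.
  have -> : D k = p * (f' (a + e) - f' z) + q * (f' a - f' z).
    rewrite /D aS -/a E.
    have -> : e * (n.+1%:R * p * q) * ((z * f z + (h z - normal_mean h)) * e) =
      e ^+ 2 * (n.+1%:R * p * q) * f' z by rewrite /f' /c; ring.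
    by rewrite enpq; ring.
  rewrite (le_trans (ler_normD _ _)) // !normrM (gtr0_norm p0) (gtr0_norm q0).
  set Q := `|e| * _.
  have -> : Q = p * Q + q * Q by ring.
  apply: lerD; rewrite ler_wpM2l ?(ltW p0) ?(ltW q0) //; apply: f'z => //;
    last by rewrite lerDl.
  by rewrite (le_trans (ler_normD _ _)) // lerD.
apply: le_trans (ler_norm_binomial_mean p01w _ _) _.
apply: le_trans (le_binomial_mean p01w n DW) _.
rewrite binomial_meanZ binomial_meanD binomial_mean_cst ler_wpM2l //.
by rewrite -!addrA lerD.
Qed.

End SteinBound.

Section Ramp.
Variable R : realType.
Implicit Types a d x y : R.
Local Notation mu := lebesgue_measure.
Local Notation w := (@normal_pdf R 0 1).
Local Notation Phi x := (\int[mu]_(t in `]-oo, x]) w t).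

(** Lipschitz approximation of the indicator of [y <= a]: it is 1 up to [a], 0 from
    [a + d] on. *)
Definition ramp (a d y : R) : R := Num.max 0 (Num.min 1 ((a + d - y) / d)).

Lemma ramp01 a d y : 0 <= ramp a d y <= 1.
Proof. by rewrite /ramp le_max lexx ge_max ler01 ge_min lexx. Qed.

Lemma ramp_lipschitz a d x y : 0 < d ->
  `|ramp a d x - ramp a d y| <= d^-1 * `|x - y|.
Proof.
move=> d0; rewrite /ramp.
have -> : d^-1 * `|x - y| = `|(a + d - x) / d - (a + d - y) / d|.
  rewrite -mulrBl normrM normfV (gtr0_norm d0) mulrC distrC.
  by congr (`|_| / _); ring.
move: ((a + d - x) / d) ((a + d - y) / d) => u v.
have := ler_norm (u - v); have := ler_norm (- (u - v)); rewrite normrN ler_norml.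
move: `|u - v| => n un nu.
by apply/andP; split; case: (leP 1 u) => ?; case: (leP 1 v) => ?;
  case: (leP 0 u) => ?; case: (leP 0 v) => ?; case: (leP 0 (1 : R)) => ?; lra.
Qed.

Lemma ramp_eq1 a d y : 0 < d -> y <= a -> ramp a d y = 1.
Proof.
move=> d0 ya; have : 1 <= (a + d - y) / d by rewrite ler_pdivlMr // mul1r; lra.
by move=> /min_idPl E; rewrite /ramp E; apply/max_idPr.
Qed.

Lemma ramp_eq0 a d y : 0 < d -> a + d <= y -> ramp a d y = 0.
Proof.
move=> d0 ya; have u0 : (a + d - y) / d <= 0 by rewrite ler_pdivrMr // mul0r; lra.
by apply/max_idPl; rewrite ge_min u0 orbT.
Qed.

Lemma normal_cdfE x : normal_prob 0 1 `]-oo, x] = (Phi x)%:E.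
Proof.
rewrite /Rintegral fineK //; apply: integrable_fin_num => //.
exact: integrable_pdf01.
Qed.

Lemma normal_mean_ramp_le a d : 0 < d -> normal_mean (ramp a d) <= Phi (a + d).
Proof.
move=> d0; have hC := lipschitz_continuous (fun x y => ramp_lipschitz a x y d0).
rewrite /normal_mean [leRHS]Rintegral_mkcond; apply: le_Rintegral => //.
- exact: integrable_mul_pdf hC (ramp01 a d).
- rewrite -restrict_EFin; apply: (integrable_mkcond _ _).1 => //.
  exact: integrable_pdf01.
move=> t _; rewrite patchE; case: ifPn => [_|].
  by have /andP[_ ?] := ramp01 a d t; rewrite ler_piMl // normal_pdf_ge0.
rewrite notin_setE /= in_itv /= => /negP; rewrite -ltNge => /ltW ta.
by rewrite ramp_eq0 // mul0r.
Qed.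

Lemma normal_mean_ramp_ge a d : 0 < d -> Phi a <= normal_mean (ramp a d).
Proof.
move=> d0; have hC := lipschitz_continuous (fun x y => ramp_lipschitz a x y d0).
rewrite /normal_mean [leLHS]Rintegral_mkcond; apply: le_Rintegral => //.
- rewrite -restrict_EFin; apply: (integrable_mkcond _ _).1 => //.
  exact: integrable_pdf01.
- exact: integrable_mul_pdf hC (ramp01 a d).
move=> t _; rewrite patchE; case: ifPn => [|_].
  by rewrite inE /= in_itv /= => ta; rewrite ramp_eq1 // mul1r.
by have /andP[? _] := ramp01 a d t; rewrite mulr_ge0 // normal_pdf_ge0.
Qed.

End Ramp.

Section BinomialCLT.
Variables (R : realType) (p : R).
Hypothesis p01 : 0 < p < 1.
Variable sigma : nat -> R.
Hypothesis sigma2 : forall n, sigma n ^+ 2 = n%:R * p * (1 - p).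
Local Notation q := (1 - p).
Local Notation standardised n k := ((k%:R - n%:R * p) / sigma n).
Local Notation Phi x := (\int[lebesgue_measure]_(t in `]-oo, x]) @normal_pdf R 0 1 t).

Let p01w : 0 <= p <= 1.
Proof. by case/andP: p01 => /ltW-> /ltW->. Qed.

Lemma binomial_mean_lipschitz_cvg (h : R -> R) (L : R) :
  (forall x, 0 <= h x <= 1) -> (forall x y, `|h x - h y| <= L * `|x - y|) ->
  binomial_mean p n (fun k => h (standardised n k)) @[n --> \oo]
    --> normal_mean h.
Proof.
move=> h01 hL; have [M MP] := binomial_stein_bound p01 h01 hL.
have [p0 p1] := andP p01.
apply/cvgrPdist_le => e e0.
(* a step of size at most [t] meets both requirements of the Stein bound *)
pose t := Num.min 1 (e / (`|M| + 1)).
have t0 : 0 < t by rewrite lt_min ltr01 divr_gt0 // ltr_wpDl.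
have [t1 tM] : t <= 1 /\ t * (`|M| + 1) <= e.
  split; first by rewrite ge_min lexx.
  by rewrite -ler_pdivlMr ?ltr_wpDl // ge_min lexx orbT.
have pqt : 0 < p * q * t ^+ 2 by rewrite !mulr_gt0 ?exprn_gt0 // subr_gt0.
near=> n.
have n0 : (0 < n)%N by near: n; exact: nbhs_infty_gt.
have nt : (p * q * t ^+ 2)^-1 <= n%:R by near: n; exact: nbhs_infty_ger.
have [m nE] : exists m, n = m.+1 by exists n.-1; rewrite prednK.
rewrite nE in nt *; rewrite distrC.
have npq0 : 0 < m.+1%:R * p * q by rewrite !mulr_gt0 // subr_gt0.
have s0 : sigma m.+1 != 0 by rewrite -sqrf_eq0 sigma2 gt_eqF.
have e2 : (sigma m.+1)^-1 ^+ 2 * (m.+1%:R * p * q) = 1.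
  by rewrite -sigma2 exprVn mulVf // sqrf_eq0.
have et : `|(sigma m.+1)^-1| <= t.
  rewrite -(@ler_pXn2r _ 2) ?nnegrE ?(ltW t0) // real_normK ?num_real //.
  rewrite exprVn sigma2 -[leRHS]invrK lef_pV2 ?posrE ?invr_gt0 ?exprn_gt0 //.
  by rewrite -mulrA mulrC -ler_pdivrMl ?mulr_gt0 ?subr_gt0 // -invfM.
apply: le_trans (MP m _ (le_trans et t1) e2) _.
apply: le_trans tM.
apply: (@le_trans _ _ (`|(sigma m.+1)^-1| * (`|M| + 1))).
  by rewrite ler_wpM2l // (le_trans (ler_norm M)) // lerDl.
by rewrite ler_wpM2r // addr_ge0.
Unshelve. all: by end_near. Qed.

(** The ramps starting at [x - d] and at [x] enclose the indicator of [y <= x], and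
    their normal means lie between [Phi (x - d)] and [Phi (x + d)].  The sign of
    [sigma n] is free, so that the statement covers both the number of successes
    and its opposite. *)
Lemma binomial_clt x : {for x, continuous (fun y => Phi y)} ->
  binomial_mean p n (fun k => (standardised n k <= x)%R%:R) @[n --> \oo]
    --> Phi x.
Proof.
move=> cx; apply/cvgrPdist_le => e e0.
have e20 : 0 < e / 2 by rewrite divr_gt0.
move/cvgrPdist_le: cx => /(_ _ e20) /nbhs_ballP[r /= r0 rx].
pose d := r / 2; have d0 : 0 < d by rewrite divr_gt0.
have dr : d < r by rewrite /d; lra.
have hi : `|Phi x - Phi (x + d)| <= e / 2.
  by apply: rx; rewrite /ball /= opprD addNKr normrN gtr0_norm.
have lo : `|Phi x - Phi (x - d)| <= e / 2.
  by apply: rx; rewrite /ball /= opprB addrC subrK gtr0_norm.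
have chi := binomial_mean_lipschitz_cvg (ramp01 x d)
  (fun y z => ramp_lipschitz x y z d0).
have clo := binomial_mean_lipschitz_cvg (ramp01 (x - d) d)
  (fun y z => ramp_lipschitz (x - d) y z d0).
have hiE := normal_mean_ramp_le x d0.
have loE := normal_mean_ramp_ge (x - d) d0.
near=> n.
have Hhi : `|normal_mean (ramp x d) -
    binomial_mean p n (fun k => ramp x d (standardised n k))| <= e / 2.
  by near: n; move/cvgrPdist_le: chi; exact.
have Hlo : `|normal_mean (ramp (x - d) d) -
    binomial_mean p n (fun k => ramp (x - d) d (standardised n k))| <= e / 2.
  by near: n; move/cvgrPdist_le: clo; exact.
have Bhi : binomial_mean p n (fun k => (standardised n k <= x)%R%:R) <=
    binomial_mean p n (fun k => ramp x d (standardised n k)).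
  apply: le_binomial_mean => // k; move: (_ / sigma n) => y.
  have [yx|_] := leP y x; first by rewrite ramp_eq1.
  by have /andP[] := ramp01 x d y.
have Blo :
    binomial_mean p n (fun k => ramp (x - d) d (standardised n k)) <=
    binomial_mean p n (fun k => (standardised n k <= x)%R%:R).
  apply: le_binomial_mean => // k; move: (_ / sigma n) => y.
  have [_|yx] := leP y x; first by have /andP[] := ramp01 (x - d) d y.
  by rewrite ramp_eq0 // subrK ltW.
move: hi lo Hhi Hlo.
by rewrite !ler_norml; lra.
Unshelve. all: by end_near. Qed.

End BinomialCLT.

(** * The number of ortho links of a random chain *)

Section OrthoCount.
Context d (T : measurableType d) (R : realType) (P : probability T R).
Variables (p1 p2 : R) (L : nat -> {RV P >-> link}).
Hypothesis rL : random_links p1 p2 L.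

(** Indexed by the number [m] of random links: a chain with [m] random links has
    [m + 2] hexagons, and its links are those of steps 3 to [m + 2]. *)
Definition ortho_count (m : nat) (x : T) : nat :=
  \sum_(3 <= i < m.+3) (L i x == Ortho).

Lemma ortho_count0 x : ortho_count 0 x = 0%N.
Proof. by rewrite /ortho_count big_geq. Qed.

Lemma ortho_countS m x :
  ortho_count m.+1 x = (ortho_count m x + (L m.+3 x == Ortho))%N.
Proof. by rewrite /ortho_count big_nat_recr. Qed.

Lemma measurable_link i (A : set link) : measurable (L i @^-1` A).
Proof. by rewrite -[X in measurable X]setTI; apply: measurable_funP. Qed.

Lemma ortho_countS_preimage m (U : set nat) :
  ortho_count m.+1 @^-1` U =
    (ortho_count m @^-1` (S @^-1` U) `&` L m.+3 @^-1` [set Ortho]) `|`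
    (ortho_count m @^-1` U `&` L m.+3 @^-1` (~` [set Ortho])).
Proof.
apply/seteqP; split => x; rewrite /preimage /= ortho_countS.
  by case: eqP => [->|LO]; rewrite ?addn1 ?addn0; [left|right].
case=> -[+ LO]; first by rewrite LO eqxx addn1.
by move/eqP/negPf: LO => ->; rewrite addn0.
Qed.

Lemma measurable_ortho_count_preimage m (U : set nat) :
  measurable (ortho_count m @^-1` U).
Proof.
elim: m U => [|m IH] U.
  rewrite (_ : ortho_count 0 = cst 0%N) ?preimage_cst; first by case: ifP.
  by apply/funext => x; rewrite ortho_count0.
rewrite ortho_countS_preimage.
by apply: measurableU; apply: measurableI => //; exact: measurable_link.
Qed.

Lemma measurable_ortho_count m : measurable_fun setT (ortho_count m).
Proof. by move=> _ U _; rewrite setTI; exact: measurable_ortho_count_preimage. Qed.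

HB.instance Definition _ m := @isMeasurableFun.Build _ _ _ _ (ortho_count m)
  (measurable_ortho_count m).

Local Open Scope ereal_scope.

(** The law of the count and its independence of later links are proved together,
    by peeling off the last link: the induction hypothesis is used for a family of
    later links enlarged by this one, constrained to be, or not to be, ortho. *)
Lemma ortho_count_independent m (U : set nat) (s : {fset nat})
    (A : nat -> set link) :
  (forall i, i \in s -> (m.+3 <= i)%N) ->
  P (ortho_count m @^-1` U `&` \bigcap_(i in [set` s]) (L i @^-1` A i)) =
  (binomial_mean p1 m (\1_U : nat -> R))%:E * \prod_(i <- s) P (L i @^-1` A i).
Proof.
have [law indep] := rL.
elim: m U s A => [|m IH] U s A sm.
  have sD : [set` s] `<=` [set i | (3 <= i)%N] by move=> i /= /sm.
  rewrite binomial_mean0 indicE -(indep s sD A) //.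
  rewrite (_ : ortho_count 0 = cst 0%N); last first.
    by apply/funext => x; rewrite ortho_count0.
  rewrite preimage_cst; case: ifP => _; first by rewrite setTI mul1e.
  by rewrite set0I measure0 mul0e.
have i0s : m.+3 \notin s by apply/negP => /sm; rewrite ltnn.
pose A' (B : set link) i := if i == m.+3 then B else A i.
have split (V : set nat) (B : set link) :
    P (ortho_count m @^-1` V `&` L m.+3 @^-1` B `&`
       \bigcap_(i in [set` s]) (L i @^-1` A i)) =
    (binomial_mean p1 m (\1_V : nat -> R))%:E * (P (L m.+3 @^-1` B) *
       \prod_(i <- s) P (L i @^-1` A i)).
  have sm' i : i \in (m.+3 |` s)%fset -> (m.+3 <= i)%N.
    by rewrite !inE => /orP[/eqP->|/sm]; lia.
  have A'i0 : A' B m.+3 = B by rewrite /A' eqxx.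
  have A's i : i \in s -> A' B i = A i.
    by move=> si; rewrite /A'; case: eqP => // iE; subst i; rewrite si in i0s.
  have := IH V (m.+3 |` s)%fset (A' B) sm'.
  rewrite big_fsetU1 // A'i0.
  rewrite [X in _ * (_ * X)](_ : _ =
    \prod_(i <- s) P (L i @^-1` A i)); last first.
    by apply: eq_big_seq => i si; rewrite A's.
  move=> <-; congr (P _); apply/seteqP; split => x /=.
    move=> [[Vx Bx] Ax]; split => // i /=; rewrite !inE => /orP[/eqP->|si].
      by rewrite A'i0.
    by rewrite A's //; exact: Ax.
  move=> [Vx Ax]; split.
    by split => //; have := Ax m.+3; rewrite /= !inE A'i0 eqxx; apply.
  by move=> i si; have := Ax i; rewrite /= !inE A's // si orbT; apply.
have mA : measurable (\bigcap_(i in [set` s]) (L i @^-1` A i)).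
  by apply: bigcap_measurableType => i _; exact: measurable_link.
have mSL V B : measurable (ortho_count m @^-1` V `&` L m.+3 @^-1` B `&`
    \bigcap_(i in [set` s]) (L i @^-1` A i)).
  apply: measurableI => //; apply: measurableI; last exact: measurable_link.
  exact: measurable_ortho_count_preimage.
have PO : P (L m.+3 @^-1` [set Ortho]) = p1%:E by rewrite law.
have PNO : P (L m.+3 @^-1` (~` [set Ortho])) = (1 - p1)%:E.
  by rewrite -preimage_setC probability_setC ?PO //; exact: measurable_link.
rewrite ortho_countS_preimage setIUl measureU.
- apply: (etrans (f_equal2 adde (split _ _) (split _ _))).
  have succE : binomial_mean p1 m (\1_(S @^-1` U) : nat -> R) =
    binomial_mean p1 m (fun k => \1_U k.+1 : R) by [].
  rewrite PO PNO binomial_meanS succE.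
  set Q := \prod_(i <- s) _.
  have Qfin : Q \is a fin_num.
    rewrite /Q; apply: prode_fin_num => i _.
    by rewrite fin_num_measure //; exact: measurable_link.
  rewrite -(fineK Qfin) -!EFinM /adde /=; congr EFin; ring.
- exact: mSL.
- exact: mSL.
- by rewrite -subset0 => x [[[_ ?] _] [[_ ?] _]].
Qed.

Lemma ortho_count_law m (U : set nat) :
  P (ortho_count m @^-1` U) = (binomial_mean p1 m (\1_U : nat -> R))%:E.
Proof.
have := @ortho_count_independent m U fset0 (fun=> setT).
rewrite big_seq_fset0 mule1 => <- //; congr (P _).
by apply/seteqP; split => x // [].
Qed.

Hypothesis p01 : (0 <= p1 <= 1)%R.

Lemma binomial_prob_mean m (U : set nat) :
  binomial_prob m p1 U = (binomial_mean p1 m (\1_U : nat -> R))%:E.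
Proof.
have [p0 p1'] := andP p01.
rewrite (@binomial_probE R m p1 p0 p1' U) /binomial_mean -sumEFin.
by apply: eq_bigr => k _; rewrite diracE EFinM indicE.
Qed.

Lemma distribution_ortho_count m (U : set nat) :
  distribution P (ortho_count m) U = binomial_prob m p1 U.
Proof. by rewrite binomial_prob_mean -ortho_count_law. Qed.

(** A function of the count takes finitely many values, so that its expectation is a
    finite sum; the integral of a signed function is split into its positive and
    negative parts. *)
Lemma expectation_ortho_count m (f : nat -> R) :
  'E_P[f \o ortho_count m] = (binomial_mean p1 m f)%:E.
Proof.
have ge0 (g : nat -> R) : (forall k, 0 <= g k)%R ->
    \int[P]_x (g (ortho_count m x))%:E = (binomial_mean p1 m g)%:E.
  move=> g0.
  have g0' k : 0 <= (EFin \o g) k by rewrite lee_fin.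
  rewrite -[LHS](ge0_integral_distribution (ortho_count m : {RV P >-> nat}) _ g0') //.
  have [p0 p1'] := andP p01.
  transitivity (\int[binomial_prob m p1]_y (g y)%:E).
    by apply: eq_measure_integral => A _ _; exact: distribution_ortho_count.
  rewrite (@integral_binomial R m p1 p0 p1') => [|k]; last by rewrite lee_fin.
  by rewrite /binomial_mean -sumEFin; apply: eq_bigr => k _; rewrite EFinM.
rewrite unlock integralE.
have pos x : (EFin \o (f \o ortho_count m))^\+ x =
    (Num.max (f (ortho_count m x)) 0)%:E.
  by rewrite funeposE /= EFin_max.
have neg x : (EFin \o (f \o ortho_count m))^\- x =
    (Num.max (- f (ortho_count m x)) 0)%:E.
  by rewrite funenegE /= EFin_max EFinN.
under eq_integral do rewrite pos.
under [X in _ - X]eq_integral do rewrite neg.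
rewrite (ge0 (fun k => Num.max (f k) 0%R)) => [|k];
  last by rewrite le_max lexx orbT.
rewrite (ge0 (fun k => Num.max (- f k)%R 0%R)) => [|k];
  last by rewrite le_max lexx orbT.
rewrite -EFinB -binomial_meanB; congr EFin; apply: eq_binomial_mean => k.
by case: (leP (f k) 0%R) => ?; case: (leP (- f k)%R 0%R) => ?; lra.
Qed.

End OrthoCount.

(** * The strong law for the number of ortho links *)

Section LLN.
Context d (T : measurableType d) (R : realType) (P : probability T R).
Variables (p1 p2 : R) (L : nat -> {RV P >-> link}).
Hypothesis rL : random_links p1 p2 L.
Hypothesis p01 : 0 <= p1 <= 1.

(** Written without division, so that the event is empty for [n = 0]. *)
Definition deviates (j n : nat) : set T :=
  [set x | n%:R < j.+1%:R * `|(ortho_count L n x)%:R - n%:R * p1|].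

Lemma measurable_deviates j n : measurable (deviates j n).
Proof.
exact: (measurable_ortho_count_preimage L n
  [set k | n%:R < j.+1%:R * `|k%:R - n%:R * p1|]).
Qed.

(** Markov's inequality for the fourth moment; the second moment would only give a
    bound of order [1 / n], which is not summable. *)
Lemma deviates_le j n :
  (P (deviates j n.+1) <= (j.+1%:R ^+ 4 * 5 / n.+1%:R ^+ 2)%:E)%E.
Proof.
rewrite (ortho_count_law rL n.+1
  [set k | n.+1%:R < j.+1%:R * `|k%:R - n.+1%:R * p1|]).
rewrite lee_fin.
have n0 : 0 < n.+1%:R ^+ 4 :> R by rewrite exprn_gt0.
apply: (@le_trans _ _ (binomial_mean p1 n.+1
  (fun k => j.+1%:R ^+ 4 / n.+1%:R ^+ 4 * (k%:R - n.+1%:R * p1) ^+ 4))).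
  apply: le_binomial_mean => // k; rewrite indicE.
  have y4 : (k%:R - n.+1%:R * p1) ^+ 4 = `|k%:R - n.+1%:R * p1| ^+ 4 :> R.
    by rewrite -normrX ger0_norm // exprn_even_ge0.
  have [|_] := boolP (k \in _);
    last by rewrite y4 mulr_ge0 ?exprn_ge0 ?divr_ge0 ?exprn_ge0.
  rewrite inE /= => /ltW nk; rewrite mulrAC ler_pdivlMr // mul1r y4 -exprMn.
  by rewrite lerXn2r ?nnegrE ?mulr_ge0.
rewrite binomial_meanZ.
apply: le_trans (ler_wpM2l _ (binomial_mean_fourth p01 _)) _.
  by rewrite divr_ge0 ?exprn_ge0.
have n1 : n.+1%:R != 0 :> R by [].
by rewrite le_eqVlt; apply/orP; left; apply/eqP; field.
Qed.

Lemma summable_deviates j : (\sum_(n <oo) P (deviates j n) < +oo)%E.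
Proof.
set C := j.+1%:R ^+ 4 * 5 : R.
have C0 : 0 <= C by rewrite mulr_ge0 ?exprn_ge0.
have dev0 : P (deviates j 0) = 0%E.
  rewrite (_ : deviates j 0 = set0) ?measure0 // -subset0 => x.
  by rewrite /deviates /= ortho_count0 mul0r subrr normr0 mulr0 ltxx.
(* 1 / n ^ 2 <= 2 (1 / n - 1 / (n + 1)) makes the partial sums telescope *)
have partial n : (\sum_(0 <= i < n.+1) P (deviates j i) <=
    (2 * C * (1 - n.+1%:R^-1))%:E)%E.
  elim: n => [|n IH]; first by rewrite big_nat1 dev0 invr1 subrr mulr0.
  rewrite big_nat_recr //=; apply: le_trans (leeD IH (deviates_le j n)) _.
  rewrite -EFinD lee_fin -/C -subr_ge0 -[n.+2%:R]natr1.
  have : 1 <= n.+1%:R :> R by rewrite ler1n.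
  move: (n.+1%:R : R) => m m1.
  have -> : 2 * C * (1 - (m + 1)^-1) - (2 * C * (1 - m^-1) + C / m ^+ 2) =
     C * (m - 1) / (m ^+ 2 * (m + 1)).
    by field; apply/andP; split; apply/eqP; lra.
  by rewrite divr_ge0 ?mulr_ge0 ?exprn_ge0 ?subr_ge0 //; lra.
apply: (@le_lt_trans _ _ (2 * C)%:E); last exact: ltry.
apply: lime_le; first by apply: is_cvg_nneseries => n _ _.
apply: nearW => -[|n]; first by rewrite big_geq // lee_fin mulr_ge0.
by apply: le_trans (partial n) _; rewrite lee_fin ler_piMr ?mulr_ge0.
Qed.

(** By the Borel-Cantelli lemma almost every outcome leaves each family of
    deviation events after finitely many steps. *)
Lemma ortho_count_slln :
  {ae P, forall x, (ortho_count L n x)%:R / n%:R @[n --> \oo] --> p1}.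
Proof.
have ae_dev : {ae P, forall x, forall j, ~ lim_sup_set (deviates j) x}.
  apply/ae_foralln => j; exists (lim_sup_set (deviates j)); split.
  - apply: bigcap_measurableType => n _; apply: bigcup_measurable => k _.
    exact: measurable_deviates.
  - apply: lim_sup_set_cvg0; first exact: measurable_deviates.
    exact: summable_deviates.
  - by move=> x /= /contrapT.
apply: filterS ae_dev => x devx.
apply/cvgrPdist_le => e e0.
pose j := Num.truncn e^-1.
have je : j.+1%:R^-1 <= e.
  by rewrite -[leRHS]invrK lef_pV2 ?posrE ?invr_gt0 // ltW // truncnS_gt.
have := devx j; rewrite /lim_sup_set /bigcap /= -existsNE => -[N].
rewrite not_implyE => -[_ devN].
near=> n.
have Nn : (N <= n)%N by near: n; exact: nbhs_infty_ge.
have n0 : 0 < n%:R :> R by rewrite ltr0n; near: n; exact: nbhs_infty_gt.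
have : ~ deviates j n x by move=> dn; apply: devN; exists n.
rewrite /deviates /= => /negP; rewrite -leNgt => dn.
apply: le_trans je.
have -> : p1 - (ortho_count L n x)%:R / n%:R =
    - ((ortho_count L n x)%:R - n%:R * p1) / n%:R.
  by field; rewrite gt_eqF.
by rewrite normrM normrN normfV (gtr0_norm n0) ler_pdivrMr // ler_pdivlMl.
Unshelve. all: by end_near. Qed.

End LLN.

(** * The random polyphenyl chain *)

Theorem corollary3p2 (R : realType) (h : nat -> nat -> R)
    (h_sym : forall x y : nat, (0 < x)%N -> (0 < y)%N -> h x y = h y x) :
  let A := h 2%N 2%N - 2 * h 2%N 3%N + h 3%N 3%N in
  let B := 2 * h 2%N 2%N + 4 * h 2%N 3%N + h 3%N 3%N in
  let C := 4 * h 2%N 2%N - 4 * h 2%N 3%N - h 3%N 3%N in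
  (forall (d : measure_display) (T : measurableType d) (P : probability T R)
      (p1 p2 : R) (L : nat -> {RV P >-> link}) (G : nat -> T -> chain),
    0 <= p1 -> 0 <= p2 -> p1 + p2 <= 1 ->
    random_polyphenyl_chain p1 p2 L G ->
    let TIn (n : nat) (w : T) : R := TI h (G n w) in
    [/\ (forall n : nat, (2 <= n)%N ->
          exists X : {RV P >-> nat},
            (forall U : set nat, distribution P X U = binomial_prob (n - 2) p1 U) /\
            (forall w : T, TIn n w = A * (X w)%:R + B * n%:R + C)),
        (forall n : nat, (2 <= n)%N ->
          ('E_P[TIn n])%E = ((A * p1 + B) * n%:R - 2 * A * p1 + C)%:E),
        (forall n : nat, (2 <= n)%N ->
          ('V_P[TIn n])%E = (A ^+ 2 * p1 * (1 - p1) * (n%:R - 2))%:E),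
        (A != 0 -> 0 < p1 < 1 ->
          cvg_in_distribution P
            (fun (n : nat) (w : T) =>
              (TIn n w - fine ('E_P[TIn n])%E) / Num.sqrt (fine ('V_P[TIn n])%E))
            (normal_prob 0 1))
      & {ae P, forall w : T, TIn n w / n%:R @[n --> \oo] --> A * p1 + B}]) /\
  (forall (l : nat -> link) (rpoc : nat -> chain) (n : nat),
    (2 <= n)%N -> polyphenyl_construction l rpoc n ->
    TI h (rpoc n) =
      A * (\sum_(3 <= i < n.+1) (l i == Ortho))%N%:R + B * n%:R + C).
Proof.
move=> A B C; split; last by move=> l G n n2; exact: TI_polyphenyl.
move=> d T P p1 p2 L G p10 p20 p12 [rL Gcon] TIn.
have p01 : 0 <= p1 <= 1 by rewrite p10 /=; lra.
have TInE m w : TIn m.+2 w = A * (ortho_count L m w)%:R + B * m.+2%:R + C.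
  by rewrite /TIn (TI_polyphenyl h_sym (n := m.+2) _ (Gcon w m.+2)).
have TIn_comp m :
    TIn m.+2 = (fun k => A * k%:R + B * m.+2%:R + C) \o ortho_count L m.
  by apply/funext => w; rewrite TInE.
have ETIn m : ('E_P[TIn m.+2] = (A * (m%:R * p1) + B * m.+2%:R + C)%:E)%E.
  rewrite TIn_comp (expectation_ortho_count rL p01) !binomial_meanD binomial_meanZ.
  by rewrite !binomial_mean_cst binomial_mean_id.
have VTIn m : ('V_P[TIn m.+2] = (A ^+ 2 * (m%:R * p1 * (1 - p1)))%:E)%E.
  rewrite /variance unlock ETIn /=.
  transitivity ('E_P[(fun k => A ^+ 2 * (k%:R - m%:R * p1) ^+ 2)%R \o
                    ortho_count L m])%E.
    congr expectation; apply/funext => w; rewrite /=.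
    transitivity ((TIn m.+2 w - (A * (m%:R * p1) + B * m.+2%:R + C)) ^+ 2) => //.
    by rewrite TInE; ring.
  by rewrite (expectation_ortho_count rL p01) binomial_meanZ binomial_mean_var.
have two m : m.+2%:R - 2 = m%:R :> R by rewrite -addn2 natrD addrK.
split.
- case=> [|[|m]] // _; rewrite subn2 /=; exists (ortho_count L m); split => [U|w].
    exact: (distribution_ortho_count rL p01).
  exact: TInE.
- by case=> [|[|m]] // _; rewrite ETIn -(two m); congr EFin; ring.
- by case=> [|[|m]] // _; rewrite VTIn two; congr EFin; ring.
- move=> A0 p1lt.
  (* the sign of [A] decides whether the index grows or decreases with the count *)
  pose sigma m := `|A| / A * Num.sqrt (m%:R * p1 * (1 - p1)).
  have npq m : 0 <= m%:R * p1 * (1 - p1) :> R.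
    by rewrite !mulr_ge0 // subr_ge0; lra.
  have sigma2 m : sigma m ^+ 2 = m%:R * p1 * (1 - p1).
    rewrite !exprMn sqr_sqrtr // exprVn real_normK ?num_real //.
    by rewrite mulfV ?mul1r // expf_neq0.
  pose Z n w := (TIn n w - fine 'E_P[TIn n]%E) / Num.sqrt (fine 'V_P[TIn n]%E).
  have ZE m w : Z m.+2 w = ((ortho_count L m w)%:R - m%:R * p1) / sigma m.
    rewrite /Z ETIn VTIn TInE /= sqrtrM ?sqr_ge0 // sqrtr_sqr /sigma.
    by rewrite !invfM invrK; ring.
  split.
    exists 2 => // -[|[|m]] //= _.
    rewrite (_ : (fun w => _) =
      (fun k => (k%:R - m%:R * p1) / sigma m) \o ortho_count L m).
      by apply: measurableT_comp => //.
    by apply/funext => w; exact: ZE.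
  move=> x.
  pose Phi y : R := \int[lebesgue_measure]_(t in `]-oo, y]) normal_pdf 0 1 t.
  have cdfE y : normal_prob 0 1 [set z : R | z <= y] = (Phi y)%:E.
    by rewrite /Phi -normal_cdfE; congr (normal_prob 0 1 _).
  move=> cx.
  have cPhi : {for x, continuous Phi}.
    have := cx; rewrite /prop_for /continuous_at [X in _ --> X](cdfE x) => /fine_cvg.
    by under [X in X @ _ --> _ -> _]eq_fun do rewrite /= cdfE.
  suff clt : (fun n => P [set w | Z (n + 2)%N w <= x]) @ \oo -->
      (normal_prob 0 1 [set z : R | z <= x] : \bar R).
    rewrite (cvg_shiftn 2 (fun n => P [set w | Z n w <= x])) in clt.
    exact: clt.
  rewrite [X in _ --> X]cdfE.
  have -> : (fun n => P [set w | Z (n + 2)%N w <= x]) =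
      (fun m => (binomial_mean p1 m
      (fun k => ((k%:R - m%:R * p1) / sigma m <= x)%R%:R))%:E).
    apply/funext => m /=; rewrite addn2.
    transitivity (P (ortho_count L m @^-1`
      [set k | (k%:R - m%:R * p1) / sigma m <= x])).
      by congr (P _); apply/funext => w; rewrite /= /preimage /= -ZE.
    rewrite (ortho_count_law rL); congr EFin; apply: eq_binomial_mean => k.
    by rewrite indicE mem_setE.
  apply: cvg_EFin; first exact: nearW.
  exact: (binomial_clt p1lt sigma2 cPhi).
- have := ortho_count_slln rL p01; apply: filterS => w Sw.
  rewrite -(cvg_shiftn 2).
  have r0 : (m.+2%:R^-1 : R) @[m --> \oo] --> (0 : R).
    by have := @cvg_harmonic R; rewrite -cvg_shiftS.
  (* the frequency is taken over [m] links but the index over [m + 2] hexagons *)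
  have -> : (fun n => TIn (n + 2)%N w / (n + 2)%:R) =
     (fun m => A * ((ortho_count L m w)%:R / m%:R) * (1 - 2 * m.+2%:R^-1) + B +
        C * m.+2%:R^-1).
    apply/funext => -[|m].
      by rewrite add0n TInE ortho_count0 mul0r mulr0 mul0r; field.
    rewrite addn2 TInE -[m.+3%:R]natr1 -[m.+2%:R]natr1.
    have : 0 < m.+1%:R :> R by [].
    by move: (m.+1%:R : R) => r r0'; field; do ?[apply/andP; split]; apply/eqP; lra.
  have -> : A * p1 + B = A * p1 * (1 - 2 * 0) + B + C * 0 by ring.
  apply: cvgD; last by apply: cvgMr.
  apply: cvgD; last exact: cvg_cst.
  apply: cvgM; first by apply: cvgMr.
  by apply: cvgB; [exact: cvg_cst|apply: cvgMr].
Qed.
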